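(* Let $q$ be a prime power. Let $V$ be a vector space of arbitrary even positive dimension $2t$ over $\mathbb{F}_q$ provided with a nondegenerate symplectic form $B$. Let $A$ be a subgroup of index $r>1$ in the additive group $\mathbb{F}_q^+$ of $\mathbb{F}_q$. Let $D=\{c_1+A,\ldots,c_K+A\}$ be a zero-free reversible $(r,K,\Lambda)$ difference set in the (elementary abelian) quotient group $\mathbb{F}_q^+/A$, and let $\widetilde{D}=(c_1+A)\cup\cdots\cup(c_K+A)\subseteq\mathbb{F}_q$. Then the graph $\Delta(2t,q,A,r,D)$ with vertex set $\{(\alpha+A,x) : \alpha\in\mathbb{F}_q,\ x\in V\}$, where $(\alpha+A,x)\sim(\beta+A,y)$ if and only if $B(x,y)\in\alpha-\beta+\widetilde{D}$, is a divisible design graph with parameters $(v,k,\lambda_1,\lambda_2,m,n)$, where $$v=q^{2t}\cdot r,\quad k=q^{2t}\cdot K,\quad \lambda_1=q^{2t}\cdot\Lambda,\quad \lambda_2=q^{2t}\cdot K^2/r,\quad m=q^{2t},\quad n=r.$$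
   Context: A divisible design graph with parameters $(v,k,\lambda_1,\lambda_2,m,n)$ is a (simple, undirected) $k$-regular graph on $v$ vertices whose vertex set can be partitioned into $m$ classes of size $n$ such that any two distinct vertices from the same class have precisely $\lambda_1$ common neighbours and any two vertices from different classes have precisely $\lambda_2$ common neighbours. A $(v,k,\lambda)$ difference set in a group $G$ of order $v$ (written additively here) is a subset $D\subseteq G$ of size $k$ such that every non-identity element of $G$ can be expressed as a difference $d_1-d_2$ with $d_1,d_2\in D$ in exactly $\lambda$ ways. Trivial difference sets (such as $\{g\}$ and $G\setminus\{g\}$) are allowed. A difference set $D$ is reversible if $-D=D$, and zero-free if it does not contain the identity element of the group; for the group $\mathbb{F}_q^+/A$ the identity element is the coset $A$. $\mathbb{F}_q^+$ denotes the additive group of the finite field $\mathbb{F}_q$. A symplectic form is an alternating bilinear form. For $\gamma\in\mathbb{F}_q$, $\gamma+\widetilde{D}=\{\gamma+d : d\in\widetilde{D}\}$. *)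

(* Defs.v *)
From HB Require Import structures.
From mathcomp Require Import all_boot all_order all_algebra.
From mathcomp Require Import all_fingroup all_field.

Set Implicit Arguments.
Unset Strict Implicit.
Unset Printing Implicit Defensive.

Import GRing.Theory.

Definition common_neighbours (T : finType) (e : rel T) (x y : T) : {set T} :=
  [set z | e x z && e y z].

Record is_ddg (T : finType) (e : rel T) (v k lambda1 lambda2 m n : nat) : Prop :=
  IsDDG {
    ddg_irr : irreflexive e;
    ddg_sym : symmetric e;
    ddg_card : #|T| = v;
    ddg_regular : forall x : T, #|[set y | e x y]| = k;
    ddg_classes : exists P : {set {set T}},
      [/\ partition P [set: T],
          #|P| = m,
          forall C : {set T}, C \in P -> #|C| = n,
          forall x y : T, x != y -> y \in pblock P x ->
            #|common_neighbours e x y| = lambda1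
        & forall x y : T, y \notin pblock P x ->
            #|common_neighbours e x y| = lambda2] }.

Section DifferenceSets.
Local Open Scope group_scope.
Variable gT : finGroupType.

(* The group law is written multiplicatively, so the difference d1 - d2 reads
   d1 * d2^-1 and -D reads D^-1. *)
Definition is_difference_set (G : {set gT}) (v k lambda : nat) (D : {set gT}) :=
  [/\ D \subset G, #|G| = v, #|D| = k
    & forall g : gT, g \in G -> g != 1 ->
        #|[set d : gT * gT | [&& d.1 \in D, d.2 \in D & d.1 * d.2^-1 == g]]|
          = lambda].

Definition reversible (D : {set gT}) := D^-1 = D.

Definition zero_free (D : {set gT}) := 1 \notin D.

End DifferenceSets.

Section Forms.
Local Open Scope ring_scope.
Variables (F : fieldType) (V : lmodType F).

(* Unlike [is_psymplectic] of sesquilinear.v, this takes a plain bilinear form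
   and asks for B(x, x) = 0 in every characteristic. *)
Definition is_symplectic_form (B : {biscalar V}) := forall x : V, B x x = 0.

Definition nondegenerate_form (B : {biscalar V}) :=
  forall x : V, (forall y : V, B x y = 0) -> x = 0.

End Forms.

Section DeltaGraph.
Local Open Scope ring_scope.
(* A finite field is, as a [finGroupType], its additive group: so A is a
   subgroup of F^+, [coset_of A] is the type of the cosets of A, i.e. of the
   elements of F^+ / A, and the coset alpha + A is [coset A alpha]. *)
Variables (F : finFieldType) (A : {group F}).

Definition coset_union (D : {set coset_of A}) : {set F} :=
  \bigcup_(c in D) (c : {set F}).

Definition translate (gamma : F) (S : {set F}) : {set F} :=
  [set gamma + d | d in S].

Variables (V : vectType F) (B : {biscalar V}) (D : {set coset_of A}).

(* [finvect_type V] is V itself, with its finite type structure. *)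
Definition delta_vertex : finType := (coset_of A * finvect_type V)%type.

(* Adjacency is computed on representatives; [delta_adjE] shows that any choice
   of representatives gives the same answer. *)
Definition delta_adj : rel delta_vertex := fun u w =>
  B u.2 w.2 \in translate (repr u.1 - repr w.1) (coset_union D).

Lemma norm_additive (a : F) : a \in 'N(A)%g.
Proof.
apply: (subsetP (cent_sub A)); apply/centP => b _; exact: addrC.
Qed.

Lemma mem_coset_union (x : F) : (x \in coset_union D) = (coset A x \in D).
Proof.
apply/bigcupP/idP => [[c cD xc]|xD].
  by rewrite (coset_mem xc).
exists (coset A x) => //.
by rewrite val_coset ?norm_additive // rcoset_refl.
Qed.

Lemma delta_adjE (alpha beta : F) (x y : V) :
  delta_adj (coset A alpha, x) (coset A beta, y)
    = (B x y \in translate (alpha - beta) (coset_union D)).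
Proof.
have transE g z : (z \in translate g (coset_union D))
                = (((coset A g)^-1 * coset A z)%g \in D).
  have -> : (z \in translate g (coset_union D)) = (- g + z \in coset_union D).
    apply/imsetP/idP => [[d dD ->]|h]; first by rewrite addKr.
    by exists (- g + z) => //; rewrite addNKr.
  rewrite mem_coset_union -morphV ?norm_additive // -morphM ?norm_additive //.
rewrite /delta_adj /= !transE.
have subE a b : coset A (a - b) = (coset A a * (coset A b)^-1)%g.
  by rewrite -morphV ?norm_additive // -morphM ?norm_additive.
by rewrite !subE !coset_reprK.
Qed.

End DeltaGraph.

(* Main.v *)
Require Import Defs.
From HB Require Import structures.
From mathcomp Require Import all_boot all_order all_algebra.
From mathcomp Require Import all_fingroup all_field.

Set Implicit Arguments.
Unset Strict Implicit.
Unset Printing Implicit Defensive.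

(** Write [Q] for the quotient group [F^+ / A] and [s(x, y)] for the class of
    [B x y] in [Q].  Adjacency of [(a, x)] and [(b, y)] reads
    [a^-1 * b * s(x, y) \in D], so for fixed [(a, x)] and [y] the element [b]
    ranges over a translate of [D]; this gives the regularity.  Loops are
    excluded by [B x x = 0] and the zero-freeness of [D], and the symmetry is
    the antisymmetry of [B] combined with [D^-1 = D].

    The classes are the fibres of the projection to [V].  A common neighbour
    [(b, y)] of [(a, x)] and [(a', x')] is the same thing as an element [y]
    together with a pair [(d1, d2)] of elements of [D] whose quotient is
    [a^-1 * a' * s(x - x', y)] ([card_common_neighbours]): [b] cancels in the
    quotient, and is recovered from [d1].  Write [N g] for
    [quotient_count D g], so that the number of common neighbours is the sum
    over [y] of [N (a^-1 * a' * s(x - x', y))].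

    If [x = x'], each term is [N] at the same nontrivial element [a^-1 * a'],
    hence is [Lambda].  If [x <> x'], then [y |-> s(x - x', y)] is a homomorphism
    from [V] onto [Q] because [B] is nondegenerate ([coset_form_surj]), so all
    its fibres have [q ^ (2 * t) / r] elements ([card_fibre]) and the sum of
    [N] over [Q], which is [K ^ 2], is multiplied by this number.  In particular
    [r] divides [q ^ (2 * t)]. *)

Import GRing.Theory.

(** * Counting in finite groups *)

(** For a [(v, k, lambda)] difference set [D] in the whole group, this is
    [lambda] for all [g != 1]. *)
Definition quotient_count (gT : finGroupType) (D : {set gT}) (g : gT) : nat :=
  #|[set d : gT * gT | [&& d.1 \in D, d.2 \in D & (d.1 * d.2^-1)%g == g]]|.

Lemma sum_quotient_count (gT : finGroupType) (D : {set gT}) :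
  \sum_g quotient_count D g = #|D| ^ 2.
Proof.
rewrite -mulnn -cardsX -sum1_card.
rewrite (partition_big (fun d : gT * gT => (d.1 * d.2^-1)%g) xpredT) //=.
apply: eq_bigr => g _; rewrite /quotient_count -sum1_card.
by apply: eq_bigl => d; rewrite !inE andbA.
Qed.

Lemma card_translate_preim (gT : finGroupType) (D : {set gT}) (g h : gT) :
  #|[set b | (g * b * h)%g \in D]| = #|D|.
Proof.
have -> : [set b | (g * b * h)%g \in D] = [set (g^-1 * d * h^-1)%g | d in D].
  apply/setP => b; rewrite inE; apply/idP/imsetP => [bD | [d dD ->]].
    by exists (g * b * h)%g; rewrite // !mulgA mulVg mul1g mulgK.
  by rewrite !mulgA mulgV mul1g mulgKV.
by apply: card_imset => d d' /mulIg/mulgI.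
Qed.

(** The pair [(a^-1 * b * s, a'^-1 * b * s')] of elements of [D] determines [b],
    and its quotient does not involve [b]; conversely a pair with that quotient
    is of this form, with [b] read off its first component. *)
Lemma card_common_translates (gT : finGroupType) (D : {set gT})
    (a a' s s' : gT) :
    (forall x y : gT, x * y = y * x)%g ->
  #|[set b | ((a^-1 * b * s)%g \in D) && ((a'^-1 * b * s')%g \in D)]|
  = quotient_count D (a^-1 * a' * (s * s'^-1))%g.
Proof.
move=> mulC.
have quotE b : ((a^-1 * b * s) * (a'^-1 * b * s')^-1
                = a^-1 * a' * (s * s'^-1))%g.
  rewrite !invMg invgK [(s'^-1 * _)%g]mulgA (mulC s'^-1%g).
  rewrite -(mulgA a^-1%g b) (mulC b) !mulgA mulgK.
  by rewrite -!mulgA; congr mulg; rewrite mulgA mulC.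
rewrite /quotient_count.
rewrite -(card_imset _ (f := fun b => (a^-1 * b * s, a'^-1 * b * s')%g));
  last by move=> b b' /(congr1 fst) /mulIg/mulgI.
congr #|pred_of_set _|; apply/setP => -[d1 d2]; rewrite inE /=.
apply/imsetP/and3P => [[b] | [d1D d2D /eqP quot_d]].
  by rewrite inE => /andP[d1D d2D] [-> ->]; rewrite quotE.
have d1E : (a^-1 * (a * d1 * s^-1) * s)%g = d1.
  by rewrite !mulgA mulVg mul1g mulgKV.
have d2E : (a'^-1 * (a * d1 * s^-1) * s')%g = d2.
  apply: invg_inj; apply: (mulgI d1).
  by rewrite quot_d -{1}d1E quotE.
by exists (a * d1 * s^-1)%g; rewrite ?d1E ?d2E // inE d1E d2E d1D.
Qed.

(** Translation by a preimage of [c * c'^-1] exchanges the fibres over [c] and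
    [c'], so all fibres of a surjective homomorphism are equipotent.  The map
    goes from an additive to a multiplicative group, hence its unbundled
    form. *)
Lemma card_fibre (W : finZmodType) (gT : finGroupType) (f : W -> gT) :
    (forall x y, f (x + y)%R = (f x * f y)%g) ->
    (forall c, exists x, f x = c) ->
  forall c, #|gT| * #|[set x | f x == c]| = #|W|.
Proof.
move=> fD f_surj c.
have fibreE c' : #|[set x | f x == c']| = #|[set x | f x == c]|.
  have [z fz] := f_surj (c * c'^-1)%g.
  rewrite -(card_imset _ (addrI z)).
  congr #|pred_of_set _|; apply/setP => x; rewrite !inE.
  apply/imsetP/eqP => [[y] | fx].
    by rewrite inE => /eqP fy ->; rewrite fD fz fy mulgKV.
  exists (x - z)%R; last by rewrite addrC subrK.
  by rewrite inE -(inj_eq (mulgI (f z))) -fD addrC subrK fx fz mulgKV.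
rewrite -[RHS]sum1_card (partition_big f xpredT) //=.
under eq_bigr => c' _ do rewrite sum1dep_card fibreE.
by rewrite sum_nat_const.
Qed.

Lemma sum_over_fibres (W : finType) (gT : finGroupType) (f : W -> gT)
    (N : gT -> nat) (h : gT) (m : nat) :
    (forall c, #|[set x | f x == c]| = m) ->
  \sum_x N (h * f x)%g = m * \sum_g N g.
Proof.
move=> f_fibre; rewrite (reindex_inj (mulgI h) (F := N)) big_distrr /=.
rewrite (partition_big f xpredT) //=; apply: eq_bigr => c _.
under eq_bigr => x /eqP -> do [].
by rewrite sum_nat_cond_const -(f_fibre c).
Qed.

Lemma card_pairs_sum (X Y : finType) (P : X -> Y -> bool) :
  #|[set w : X * Y | P w.1 w.2]| = \sum_y #|[set b | P b y]|.
Proof.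
rewrite -sum1dep_card -(pair_big_dep xpredT P (fun _ _ => 1)) /=.
rewrite (exchange_big_dep xpredT) //=.
by apply: eq_bigr => y _; rewrite sum1dep_card.
Qed.

(** * The form modulo [A] *)

Lemma coset_additiveD (F : finFieldType) (A : {group F}) (a b : F) :
  coset A (a + b)%R = (coset A a * coset A b)%g.
Proof. by rewrite -morphM ?norm_additive. Qed.

Lemma coset_additiveN (F : finFieldType) (A : {group F}) (a : F) :
  coset A (- a)%R = (coset A a)^-1%g.
Proof. by rewrite -morphV ?norm_additive. Qed.

Lemma coset_additiveC (F : finFieldType) (A : {group F}) (a b : coset_of A) :
  (a * b = b * a)%g.
Proof.
by rewrite -[a]coset_reprK -[b]coset_reprK -!coset_additiveD addrC.
Qed.

Lemma symplectic_antisym (F : fieldType) (V : lmodType F) (B : {biscalar V}%R) :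
  is_symplectic_form B -> forall x y, (B y x = - B x y)%R.
Proof.
move=> Balt x y; apply/eqP; rewrite -addr_eq0 addrC.
have /eqP := Balt (x + y)%R.
by rewrite linearDl !linearDr /= !Balt add0r addr0.
Qed.

(** Nondegeneracy makes [B z] a nonzero linear form, and such a form already
    takes all values in [F]. *)
Lemma coset_form_surj (F : finFieldType) (A : {group F}) (V : vectType F)
    (B : {biscalar V}%R) (z : V) :
    nondegenerate_form B -> z <> 0%R ->
  forall c : coset_of A, exists y, coset A (B z y) = c.
Proof.
move=> Bnd nz_z c.
have /existsP[y nz_Bzy] : [exists y : finvect_type V, B z y != 0%R].
  apply: contra_notT nz_z => /existsPn Bz0.
  by apply: Bnd => y; apply/eqP; have := Bz0 y; rewrite negbK.
exists ((repr c / B z y) *: (y : V))%R.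
by rewrite linearZr /= divfK // coset_reprK.
Qed.

(** * The graph *)

Lemma delta_adj_coset (F : finFieldType) (A : {group F}) (V : vectType F)
    (B : {biscalar V}%R) (D : {set coset_of A}) (a b : coset_of A)
    (x y : finvect_type V) :
  delta_adj B D (a, x) (b, y) = ((a^-1 * b * coset A (B x y))%g \in D).
Proof.
rewrite -{1}[a]coset_reprK -{1}[b]coset_reprK delta_adjE.
have -> : (a^-1 * b * coset A (B x y))%g
        = coset A (- (repr a - repr b) + B x y)%R.
  by rewrite !(coset_additiveD, coset_additiveN) !coset_reprK invMg invgK
             [(b * _)%g]coset_additiveC.
rewrite -mem_coset_union.
apply/imsetP/idP => [[d dD ->]|h]; first by rewrite addKr.
by exists (- (repr a - repr b) + B x y)%R; rewrite // addNKr.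
Qed.

Lemma card_delta_neighbours (F : finFieldType) (A : {group F}) (V : vectType F)
    (B : {biscalar V}%R) (D : {set coset_of A}) (u : delta_vertex A V) :
  #|[set w | delta_adj B D u w]| = #|finvect_type V| * #|D|.
Proof.
case: u => a x.
have -> : [set w | delta_adj B D (a, x) w] =
  [set w : delta_vertex A V | (a^-1 * w.1 * coset A (B x w.2))%g \in D].
  by apply/setP => -[b y]; rewrite !inE delta_adj_coset.
rewrite (card_pairs_sum (fun (b : coset_of A) (y : finvect_type V) =>
  (a^-1 * b * coset A (B x y))%g \in D)).
by under eq_bigr => y _ do rewrite card_translate_preim; rewrite sum_nat_const.
Qed.

Lemma card_common_neighbours (F : finFieldType) (A : {group F})
    (V : vectType F) (B : {biscalar V}%R) (D : {set coset_of A})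
    (a a' : coset_of A) (x x' : finvect_type V) :
  #|common_neighbours (delta_adj B D) (a, x) (a', x')|
  = \sum_(y : finvect_type V)
      quotient_count D (a^-1 * a' * coset A (B (x - x')%R y))%g.
Proof.
pose P (b : coset_of A) (y : finvect_type V) :=
  ((a^-1 * b * coset A (B x y))%g \in D) &&
  ((a'^-1 * b * coset A (B x' y))%g \in D).
have -> : common_neighbours (delta_adj B D) (a, x) (a', x')
          = [set w | P w.1 w.2].
  by apply/setP => -[b y]; rewrite !inE !delta_adj_coset.
rewrite card_pairs_sum; apply: eq_bigr => y _.
have -> : coset A (B (x - x')%R y)
          = (coset A (B x y) * (coset A (B x' y))^-1)%g.
  by rewrite linearBl coset_additiveD coset_additiveN.
by apply: card_common_translates; apply: coset_additiveC.
Qed.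

Theorem theorem3p1 (q t r K Lambda : nat)
  (F : finFieldType) (hq : #|F| = q)
  (V : vectType F) (ht : 0 < t) (hV : \dim {:V} = 2 * t)
  (B : {biscalar V}%R)
  (hBsymp : is_symplectic_form B) (hBnondeg : nondegenerate_form B)
  (A : {group F}) (hA : #|[set: F] : A|%g = r) (hr : 1 < r)
  (D : {set coset_of A})
  (hD : is_difference_set ([set: F] / A)%g r K Lambda D)
  (hDrev : reversible D) (hDzf : zero_free D) :
  r %| q ^ (2 * t) * K ^ 2
  /\ is_ddg (delta_adj B D)
       (q ^ (2 * t) * r)
       (q ^ (2 * t) * K)
       (q ^ (2 * t) * Lambda)
       ((q ^ (2 * t) * K ^ 2) %/ r)
       (q ^ (2 * t))
       r.
Proof.
case: hD => _ cardQ cardD D_quot.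
rewrite quotientT in D_quot cardQ; rewrite cardsT in cardQ.
have r_gt0 : 0 < r by apply: ltnW.
have cardV : #|finvect_type V| = q ^ (2 * t).
  rewrite -hq -hV.
  by rewrite -(card_vspacef (Vector.class (finvect_type V))) card_vspace.
have fibre_form (z : finvect_type V) : z <> 0%R -> forall c : coset_of A,
    r * #|[set y : finvect_type V | coset A (B z y) == c]| = q ^ (2 * t).
  move=> nz_z c; rewrite -cardQ -cardV; apply: card_fibre => [x y|].
    by rewrite linearDr coset_additiveD.
  exact: coset_form_surj.
(* Any nonzero vector gives the divisibility; one exists because [t > 0]. *)
have nz_pick : (vpick {:V} != 0)%R.
  by rewrite vpick0 -dimv_eq0 hV muln_eq0 -lt0n ht.
have r_dvd : r %| q ^ (2 * t).
  by rewrite -(fibre_form (vpick {:V}) (elimN eqP nz_pick) 1%g) dvdn_mulr.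
split; first exact: dvdn_mulr.
split.
- move=> [a x]; rewrite delta_adj_coset mulVg mul1g hBsymp.
  by rewrite (morph1 (coset_morphism A)); apply: negbTE.
- move=> [a x] [b y]; rewrite !delta_adj_coset (symplectic_antisym hBsymp x y).
  rewrite coset_additiveN -{1}hDrev inE !invMg !invgK.
  by rewrite coset_additiveC.
- by rewrite card_prod cardQ cardV mulnC.
- by move=> u; rewrite card_delta_neighbours cardV cardD.
pose P := preim_partition (fun u : delta_vertex A V => u.2) setT.
have partP : partition P setT by apply: preim_partitionP.
have mem_blockE u w : (w \in pblock P u) = (u.2 == w.2).
  apply: (@pblock_equivalence_partition _ (fun u w => u.2 == w.2)) => //.
  by move=> u1 u2 u3 _ _ _; split=> // /eqP ->.
have card_block : forall C, C \in P -> #|C| = r.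
  move=> C PC; have [_ tiP P0] := and3P partP.
  have /set0Pn[u Cu] : C != set0 by apply: contraNneq P0 => <-.
  rewrite -(def_pblock tiP PC Cu).
  have -> : pblock P u = setX setT [set u.2].
    by apply/setP => -[b y]; rewrite mem_blockE !inE eq_sym.
  by rewrite cardsX cardsT cards1 cardQ muln1.
exists P; split=> //.
- have /eqP := card_uniform_partition card_block partP.
  by rewrite cardsT card_prod cardQ cardV mulnC eqn_pmul2r // eq_sym => /eqP.
- move=> [a x] [a' x'] neq_u; rewrite mem_blockE /= => /eqP eq_x; subst x'.
  rewrite card_common_neighbours -cardV -sum_nat_const; apply: eq_bigr => y _.
  rewrite subrr linear0l (morph1 (coset_morphism A)) mulg1.
  apply: D_quot; rewrite ?inE //.
  apply: contraNneq neq_u => /(canRL (mulKVg _)).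
  by rewrite mulg1 => ->.
- move=> [a x] [a' x']; rewrite mem_blockE /= => neq_x.
  have nz_x : (x - x')%R <> 0%R by apply/eqP; rewrite subr_eq0.
  rewrite card_common_neighbours.
  rewrite (@sum_over_fibres _ _
             (fun y : finvect_type V => coset A (B (x - x')%R y)) _ _
             (q ^ (2 * t) %/ r)) => [|c]; last first.
    by rewrite -(fibre_form _ nz_x c) mulKn.
  by rewrite sum_quotient_count cardD divn_mulAC.
Qed.
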